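(* Let $n, m$ be positive integers and let $A = (A_{ij}) \in \mathbb{R}^{m \times m}$ be a positive semidefinite matrix such that $A_{ij} \leq 0$ for all $i \neq j$ and $\sum_{i=1}^m A_{ij} = 0$ for every $j = 1, \ldots, m$ (for instance, the Laplacian matrix of a weighted graph with nonnegative edge weights). Let $$v(n) = \min\left\{\frac{1 - E_n(t)}{1 - t} : t \in [-1,1)\right\}.$$ Then, on input $A$, the randomized rounding algorithm described in the context has approximation ratio $v(n)$ for $\mathrm{SDP}_n$: its output $x_1, \ldots, x_m \in S^{n-1}$ satisfies $$\mathbb{E}\Bigl[\sum_{i=1}^m \sum_{j=1}^m A_{ij}\, x_i \cdot x_j\Bigr] \geq v(n)\, \mathrm{SDP}_{\infty}(A).$$
   Context: Positive semidefinite matrices are real symmetric, and $S^{n-1} = \{x \in \mathbb{R}^n : x \cdot x = 1\}$. For a positive semidefinite $A \in \mathbb{R}^{m\times m}$, $$\mathrm{SDP}_n(A) = \max\Bigl\{\sum_{i,j=1}^m A_{ij}\, x_i \cdot x_j : x_1, \ldots, x_m \in S^{n-1}\Bigr\},\qquad \mathrm{SDP}_{\infty}(A) = \max\Bigl\{\sum_{i,j=1}^m A_{ij}\, u_i \cdot u_j : u_1, \ldots, u_m \in S^{\infty}\Bigr\},$$ where $S^{\infty}$ is the unit sphere of the real Hilbert space of square summable sequences (equivalently, one may take $u_i \in S^{m-1}$). Note $\mathrm{SDP}_\infty(A) \geq \mathrm{SDP}_n(A)$. The algorithm: (1) Solve $\mathrm{SDP}_\infty(A)$, obtaining optimal vectors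 $u_1, \ldots, u_m \in S^{m-1}$ (the numerical precision error of this step is disregarded). (2) Choose $X = (X_{ij}) \in \mathbb{R}^{n \times m}$ with independent standard normal entries $X_{ij} \sim N(0,1)$. (3) Output $x_i = X u_i / \|X u_i\| \in S^{n-1}$ for $i = 1, \ldots, m$ (defined almost surely). The function $E_n : [-1,1] \to \mathbb{R}$ is defined by $$E_n(t) = \mathbb{E}\left[\frac{Xu}{\|Xu\|} \cdot \frac{Xv}{\|Xv\|}\right],$$ where $u, v \in S^{d-1}$ ($d \geq 2$) are any unit vectors with $u \cdot v = t$ and $X \in \mathbb{R}^{n \times d}$ has independent standard normal entries; by orthogonal invariance this depends only on $t$ and not on the choice of $d, u, v$. *)

(* Defs.v *)
From HB Require Import structures.
From mathcomp Require Import all_boot all_order all_algebra.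
From mathcomp Require Import all_classical all_reals all_analysis.

Set Implicit Arguments.
Unset Strict Implicit.
Unset Printing Implicit Defensive.

Import Order.TTheory GRing.Theory Num.Theory.
Import numFieldNormedType.Exports.

Local Open Scope classical_set_scope.
Local Open Scope ring_scope.

Section Vectors.
Context {R : realType}.

Definition dotp {n : nat} (x y : 'cV[R]_n) : R := \sum_(k < n) x k 0 * y k 0.

(* The library norm `|x| on matrices is the sup norm, hence this definition. *)
Definition enorm {n : nat} (x : 'cV[R]_n) : R := Num.sqrt (dotp x x).

(* The unit sphere S^{n-1} of R^n. *)
Definition usphere {n : nat} : set 'cV[R]_n := [set x | dotp x x = 1].

Definition l2dot (u v : R^nat) : R := limn (series (fun k => u k * v k)).

(* S^oo: square summable sequences of norm 1. *)
Definition l2sphere : set (R^nat) :=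
  [set u | series (fun k => u k ^+ 2) @ \oo --> (1 : R)].

Definition psd {m : nat} (A : 'M[R]_m) : Prop :=
  A^T = A /\ forall x : 'cV[R]_m, 0 <= (x^T *m A *m x) 0 0.

(* The set of values is nonempty (for every m) and bounded, and its supremum is
   attained (already by vectors of S^{m-1}), so [sup] is the maximum. *)
Definition SDPoo {m : nat} (A : 'M[R]_m) : R :=
  sup [set \sum_(i < m) \sum_(j < m) A i j * l2dot (u i) (u j)
      | u in [set u : 'I_m -> R^nat | forall i, l2sphere (u i)]].

Definition SDPoo_optimal {m : nat} (A : 'M[R]_m) (u : 'I_m -> 'cV[R]_m) : Prop :=
  (forall i, usphere (u i)) /\
  \sum_(i < m) \sum_(j < m) A i j * dotp (u i) (u j) = SDPoo A.

(* X u / ||X u||, with the value 0 when X u = 0. *)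
Definition rounding {n d : nat} (X : 'M[R]_(n, d)) (u : 'cV[R]_d) : 'cV[R]_n :=
  (enorm (X *m u))^-1 *: (X *m u).

End Vectors.

Section Gaussian.
Context {R : realType}.

Definition mutually_independent {d : measure_display} {T : measurableType d}
    (P : probability T R) {I : finType} (X : I -> {RV P >-> R}) : Prop :=
  forall (J : {set I}) (B : I -> set R), (forall i, measurable (B i)) ->
    P (\bigcap_(i in [set` J]) (X i @^-1` B i)) =
    (\prod_(i in J) P (X i @^-1` B i))%E.

Definition standard_gaussian {d : measure_display} {T : measurableType d}
    (P : probability T R) {n k : nat} (X : 'I_n -> 'I_k -> {RV P >-> R}) : Prop :=
  mutually_independent (fun ij : 'I_n * 'I_k => X ij.1 ij.2) /\
  forall i j (B : set R), measurable B ->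
    distribution P (X i j) B = normal_prob 0 1 B.

Definition matrix_at {d : measure_display} {T : measurableType d}
    (P : probability T R) {n k : nat} (X : 'I_n -> 'I_k -> {RV P >-> R})
    (w : T) : 'M[R]_(n, k) := \matrix_(i, j) X i j w.

(* [En_value n t e]: e is the expectation of Xu/||Xu|| . Xv/||Xv|| for some
   choice of the dimension k >= 2, of u, v in S^{k-1} with u . v = t, and of an
   n x k standard Gaussian matrix X on some probability space. *)
Definition En_value (n : nat) (t e : R) : Prop :=
  exists (k : nat) (u v : 'cV[R]_k) (d : measure_display) (T : measurableType d)
         (P : probability T R) (X : 'I_n -> 'I_k -> {RV P >-> R}),
    [/\ (2 <= k)%N, usphere u /\ usphere v, dotp u v = t,
        standard_gaussian X &
        'E_P[fun w => dotp (rounding (matrix_at X w) u)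
                           (rounding (matrix_at X w) v)]%E = e%:E].

(* For t in [-1, 1] the value e above exists and does not depend on the choices
   (orthogonal invariance); E_n(t) is that value. *)
Definition En (n : nat) (t : R) : R := xget 0 [set e | En_value n t e].

(* The quotients are nonnegative, so [inf] is the minimum when it is attained. *)
Definition vn (n : nat) : R :=
  inf [set (1 - En n t) / (1 - t) | t in [set t : R | -1 <= t < 1]].

End Gaussian.

(* Main.v *)
Require Import Defs.
From mathcomp Require Import all_boot all_order all_algebra.
From mathcomp Require Import all_classical all_reals all_analysis.
From mathcomp Require Import measurable_realfun ring lra.

Import Order.TTheory GRing.Theory Num.Theory.
Import numFieldNormedType.Exports.

Local Open Scope classical_set_scope.
Local Open Scope ring_scope.

(** Why the theorem holds.  The columns of A sum to 0 and A is symmetric, so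
    the rows sum to 0 as well and, for every array f,
      sum_ij A_ij f_ij = sum_ij (- A_ij) (1 - f_ij).
    Off the diagonal - A_ij is nonnegative.  Apply the identity to the expected
    inner products e_ij = E[x_i . x_j] and to t_ij = u_i . u_j.  The diagonal
    terms vanish on both sides because x_i is almost surely a unit vector, and
    for i <> j the inequality 1 - e_ij >= v(n) (1 - t_ij) is the definition of
    v(n), provided that e_ij = E_n(t_ij).

    The substance is this last identity.  [En] picks some value of the
    expectation for some choice of the dimension, of the two vectors and of the
    Gaussian matrix, so all these choices must be shown to give the same number
    ([En_value_unique]).  The proof brings every choice to one normal form
    ([gaussian_image_pair]): for unit vectors u, v with u . v = t there is an
    n x 2 matrix (Z, Z') of independent standard normal variables with
      X u = Z  and  X v = t Z + sqrt (1 - t^2) Z'.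
    The expectation is then the integral of a fixed bounded measurable function
    of (Z, Z'), which depends only on the law of (Z, Z'), and this law is fixed
    by its values on boxes ([iid_normal_integral_unique]).

    The normal form comes from orthogonal invariance, obtained without any
    n-dimensional change of variables.  A planar reflection preserves the
    product of two standard normal laws ([normal_prod_reflection]): its density
    depends only on x^2 + y^2, and the reflection splits into two affine changes
    of one variable each, separated by an exchange of the order of integration.
    Hence reflecting two columns of a Gaussian matrix gives a Gaussian matrix.
    As in Gaussian elimination by Givens rotations, finitely many such
    reflections and sign changes carry u to the first basis vector and v into
    the span of the first two ([gaussian_isometry_pair]). *)

Set Implicit Arguments.
Unset Strict Implicit.
Unset Printing Implicit Defensive.

(** * The Gaussian measure on the line and on the plane *)

Section gaussian_line.
Context {R : realType}.
Local Notation mu := (@lebesgue_measure R).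
Local Notation gauss := (normal_prob (0 : R) 1).
Local Notation phi := (normal_pdf (0 : R) 1).

(** Lebesgue measure is determined by its values on the intervals ]c, d], and
    the preimage of such an interval is an interval of length (d - c) / a. *)
Lemma lebesgue_measure_affine (a b : R) (A : set R) : 0 < a -> measurable A ->
  mu A = (a%:E * mu ((fun x => a * x + b)%R @^-1` A))%E.
Proof.
move=> a0 mA.
have mf : measurable_fun [set: measurableTypeR R]
    ((fun x => a * x + b)%R : measurableTypeR R -> measurableTypeR R).
  by apply: measurable_funD => //; exact: measurable_funM.
pose f := (fun x => a * x + b)%R : measurableTypeR R -> measurableTypeR R.
pose nu : {measure set (measurableTypeR R) -> \bar R} :=
  mscale (NngNum (ltW a0)) (pushforward mu f).
change (mu A = nu mf A); apply: lebesgue_measure_unique => // _ [[c d]] _ <-.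
rewrite /nu/= /mscale/=.
have -> : pushforward mu f `]c, d] = mu `](c - b) / a, (d - b) / a]%classic.
  congr (mu _); apply/seteqP; split => x /=;
  rewrite !in_itv/= ltr_pdivrMr// ler_pdivlMr//;
  by rewrite ltrBlDr lerBrDr mulrC.
rewrite !lebesgue_measure_itv/= !lte_fin ltr_pM2r ?invr_gt0// ltrD2r.
case: ifP => _; last by rewrite mule0.
by rewrite -!EFinD -EFinM -mulrBl mulrC divfK ?gt_eqF//; congr EFin; ring.
Qed.

Lemma ge0_integral_affine (a b : R) (f : R -> \bar R) : 0 < a ->
  measurable_fun [set: R] f -> (forall x, 0 <= f x)%E ->
  (\int[mu]_x f x = a%:E * \int[mu]_x f (a * x + b)%R)%E.
Proof.
move=> a0 mf f0.
have mh : measurable_fun [set: measurableTypeR R]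
    ((fun x => a * x + b)%R : measurableTypeR R -> measurableTypeR R).
  by apply: measurable_funD => //; exact: measurable_funM.
have := @ge0_integral_pushforward _ _ (measurableTypeR R) (measurableTypeR R) R
  _ mh mu setT f measurableT mf (fun x _ => f0 x).
rewrite preimage_setT /= => <-.
pose h := (fun x => a * x + b)%R : measurableTypeR R -> measurableTypeR R.
pose nu : {measure set (measurableTypeR R) -> \bar R} := pushforward mu h.
rewrite -[a]/((NngNum (ltW a0))%:num).
rewrite -(@ge0_integral_mscale _ _ _ (nu mh))//.
by apply: eq_measure_integral => /= A mA _; exact: lebesgue_measure_affine.
Qed.

(** The density of the normal law is its Radon-Nikodym derivative, because both
    have the same integral over every measurable set. *)
Lemma integral_normal_prob (f : R -> \bar R) :
  measurable_fun [set: R] f -> (\int[gauss]_x `|f x| < +oo)%E ->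
  (\int[gauss]_x f x = \int[mu]_x (f x * (phi x)%:E))%E.
Proof.
move=> mf finf.
have dom := normal_prob_dominates (0 : R) 1.
rewrite -(Radon_Nikodym_change_of_variables dom)//=; last first.
  by apply/integrableP; split.
apply: ae_eq_integral => //.
- apply: emeasurable_funM => //; apply: (measurable_int mu).
- apply: emeasurable_funM => //=; apply/measurableT_comp => //=.
  exact: measurable_normal_pdf.
- apply: ae_eqe_mul2l => /=.
  rewrite Radon_NikodymE/=; case: cid => /= h [h1 h2 h3].
  apply: integral_ae_eq => //=.
  + by apply/measurableT_comp => //; exact: measurable_normal_pdf.
  + by move=> E E01 mE; rewrite -h3.
Qed.

(** The product density is a function of x^2 + y^2, which the reflection with
    matrix ((c, s), (s, -c)) leaves unchanged. *)
Lemma normal_pdf_reflection (c s x y : R) : c ^+ 2 + s ^+ 2 = 1 ->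
  phi (c * x + s * y) * phi (s * x - c * y) = phi x * phi y.
Proof.
move=> cs; rewrite !normal_pdfE ?oner_eq0// /normal_fun !subr0.
rewrite mulrACA [RHS]mulrACA -!expRD; congr (_ * expR _).
rewrite -!mulrDl; congr (_ / _).
transitivity (- ((c ^+ 2 + s ^+ 2) * (x ^+ 2 + y ^+ 2))); first by ring.
by rewrite cs; ring.
Qed.

Lemma normal_probN (B : set R) : measurable B -> gauss (-%R @^-1` B) = gauss B.
Proof.
move=> mB; rewrite /normal_prob.
have mN : measurable_fun [set: measurableTypeR R]
    (-%R : measurableTypeR R -> measurableTypeR R) by [].
have mphi : measurable_fun B (fun x => (phi x)%:E).
  apply/measurable_EFinP; apply: measurable_funTS; exact: measurable_normal_pdf.
have := @ge0_integral_pushforward _ _ (measurableTypeR R) (measurableTypeR R) R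
  _ mN mu B (fun x => (phi x)%:E) mB mphi _.
move=> /(_ (fun x _ => normal_pdf_ge0 _ _ x)) H.
transitivity (\int[mu]_(x in -%R @^-1` B) ((fun x => (phi x)%:E) \o -%R) x)%E.
  apply: eq_integral => x _ /=; congr EFin.
  by rewrite !normal_pdfE ?oner_eq0// /normal_fun !subr0 sqrrN.
rewrite -H; apply: eq_measure_integral => A mA _; exact: lebesgue_measureN.
Qed.

Lemma normal_prob_fin_num (B : set R) : measurable B -> gauss B \is a fin_num.
Proof. exact: (@fin_num_measure _ _ R gauss B). Qed.

End gaussian_line.

Section gaussian_plane.
Context {R : realType}.
Local Notation mu := (@lebesgue_measure R).
Local Notation gauss := (normal_prob (0 : R) 1).
Local Notation phi := (normal_pdf (0 : R) 1).

Lemma normal_prod_measureE (S : set (R * R)) : measurable S ->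
  ((gauss \x gauss) S =
   \int[mu]_x \int[mu]_y (\1_S (x, y) * (phi x * phi y))%:E)%E.
Proof.
move=> mS; rewrite /product_measure1 integral_normal_prob; last 2 first.
- exact: measurable_fun_xsection.
- apply: (@le_lt_trans _ _ (\int[gauss]_x cst 1 x)%E).
    apply: ge0_le_integral => //=.
    + by apply: measurableT_comp => //; exact: measurable_fun_xsection.
    + move=> x _; rewrite gee0_abs ?measure_ge0//.
      by apply: probability_le1; exact: measurable_xsection.
  by rewrite integral_cst//= mul1e probability_setT ltry.
apply: eq_integral => x _ /=; rewrite /normal_prob.
have mx : measurable (xsection S x) by exact: measurable_xsection.
rewrite -ge0_integralZr//=; last 3 first.
- by apply/measurable_EFinP/measurable_funTS; exact: measurable_normal_pdf.
- by move=> y _; rewrite lee_fin normal_pdf_ge0.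
- by rewrite lee_fin normal_pdf_ge0.
rewrite integral_mkcond; apply: eq_integral => y _ /=.
rewrite patchE mem_xsection indicE; case: ifP => _; last by rewrite mul0r.
by rewrite mul1r -EFinM mulrC.
Qed.

(** Substitute z = c x + s y for y at fixed x, exchange the integrals, then
    substitute w = (x - c z) / s for x at fixed z: the factors 1 / s and s
    cancel, and (z, w) is the image of (x, y) under the reflection.  The
    hypothesis 0 < s keeps both substitutions increasing. *)
Lemma normal_prod_reflection (c s : R) (B C : set R) :
  0 < s -> c ^+ 2 + s ^+ 2 = 1 -> measurable B -> measurable C ->
  ((gauss \x gauss) ((fun p => (c * p.1 + s * p.2, s * p.1 - c * p.2)%R)
                       @^-1` (B `*` C)) = gauss B * gauss C)%E.
Proof.
move=> s0 cs mB mC; have sn0 : s != 0 by rewrite gt_eqF.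
have mphi : measurable_fun [set: R] phi by exact: measurable_normal_pdf.
have mBC : measurable (B `*` C) by exact: measurableX.
have m1 : measurable_fun setT (fst : R * R -> R) by exact: measurable_fst.
have m2 : measurable_fun setT (snd : R * R -> R) by exact: measurable_snd.
have mlin (a b : R) : measurable_fun setT (fun p : R * R => a * p.1 + b * p.2).
  by apply: measurable_funD; exact: measurable_funM.
have mrefl : measurable_fun setT
    (fun p : R * R => (c * p.1 + s * p.2, s * p.1 - c * p.2)).
  apply/measurable_fun_pairP; split => /=; first exact: mlin.
  by under eq_fun do rewrite -mulNr; exact: mlin.
rewrite normal_prod_measureE; last first.
  by rewrite -[X in measurable X]setTI; exact: mrefl.
rewrite -product_measure1E// normal_prod_measureE//.
have indic_pair (D : set R) (E : set R) (f : R * R -> R * R) p :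
    \1_(f @^-1` (D `*` E)) p = \1_D (f p).1 * \1_E (f p).2 :> R.
  rewrite !indicE -natrM mulnb; congr (_%:R); congr nat_of_bool.
  by apply/idP/andP; rewrite !inE.
have indic_rect (D : set R) (E : set R) p :
    \1_(D `*` E) p = \1_D p.1 * \1_E p.2 :> R by exact: (indic_pair D E id).
(* The integrand after the first substitution, p being (x, z). *)
pose h (p : R * R) : R := s^-1 * (\1_B p.2 * \1_C (s^-1 * p.1 + - c / s * p.2)
   * (phi p.1 * phi (s^-1 * p.2 + - c / s * p.1))).
have h0 p : (0 <= (h p)%:E)%E.
  by rewrite lee_fin /h !mulr_ge0 ?normal_pdf_ge0// invr_ge0 ltW.
have mh : measurable_fun setT (fun p => (h p)%:E).
  apply/measurable_EFinP; apply: measurable_funM => //.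
  apply: measurable_funM; apply: measurable_funM.
  - by apply: measurableT_comp => //; exact: measurable_indic.
  - apply: (@measurableT_comp _ _ _ _ _ _ (\1_C : R -> R)).
      exact: measurable_indic.
    exact: mlin.
  - exact: measurableT_comp.
  - apply: measurableT_comp => //.
    by under eq_fun do rewrite addrC; exact: mlin.
have mrho : measurable_fun setT (fun p : R * R =>
    (\1_((fun p => (c * p.1 + s * p.2, s * p.1 - c * p.2)) @^-1` (B `*` C)) p
      * (phi p.1 * phi p.2))%:E).
  apply/measurable_EFinP; apply: measurable_funM; last first.
    by apply: measurable_funM; exact: measurableT_comp.
  by apply: measurable_indic; rewrite -[X in measurable X]setTI; exact: mrefl.
have mpre (a b : R) : measurable_fun [set: R] (fun x => a * x + b).
  by apply: measurable_funD => //; exact: measurable_funM.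
transitivity (\int[mu]_x \int[mu]_z (h (x, z))%:E)%E.
  apply: eq_integral => x _.
  have mx := measurable_fun_pair2 x mrho.
  rewrite (@ge0_integral_affine _ s^-1 (- c / s * x)) ?invr_gt0//; first last.
    by move=> y; rewrite lee_fin !mulr_ge0 ?normal_pdf_ge0.
  rewrite -ge0_integralZl//=; first last.
  - by rewrite lee_fin invr_ge0 ltW.
  - by move=> y _; rewrite lee_fin !mulr_ge0 ?normal_pdf_ge0.
  - exact: (measurableT_comp mx (mpre _ _)).
  apply: eq_integral => z _; rewrite -EFinM /h/= indic_pair/=.
  have -> : c * x + s * (s^-1 * z + - c / s * x) = z by field.
  suff -> : s * x - c * (s^-1 * z + - c / s * x) = s^-1 * x + - c / s * z by [].
  rewrite -[X in _ = X * x + _]mul1r -cs; field.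
  exact: sn0.
transitivity (\int[mu]_z \int[mu]_x (h (x, z))%:E)%E.
  exact: (@fubini_tonelli _ _ (measurableTypeR R) (measurableTypeR R) R mu mu
    (fun p => (h p)%:E) mh h0).
apply: eq_integral => z _.
have mz := measurable_fun_pair1 z mh.
rewrite (@ge0_integral_affine _ s (c * z))//.
rewrite -ge0_integralZl//=; first last.
- by rewrite lee_fin ltW.
- exact: (measurableT_comp mz (mpre _ _)).
apply: eq_integral => w _; rewrite -EFinM /h/= mulVKf//.
have -> : s^-1 * (s * w + c * z) + - c / s * z = w by field.
have -> : s^-1 * z + - c / s * (s * w + c * z) = s * z - c * w.
  transitivity (s^-1 * (c ^+ 2 + s ^+ 2) * z + - c / s * (s * w + c * z)).
    by rewrite cs mulr1.
  by field.
rewrite indic_rect/= [s * w + _]addrC normal_pdf_reflection//.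
Qed.

End gaussian_plane.

(** * Families of independent standard normal variables *)

Section family.
Context {R : realType} {d : measure_display} {T : measurableType d}.
Variable P : probability T R.
Local Notation gauss := (normal_prob (0 : R) 1).

(** Independence and the marginal laws in a single product formula over boxes.
    The functions X i carry no bundled measurability, so that families derived
    from X need not be repackaged as random variables; [fine] keeps the product
    among the reals. *)
Definition iid_normal (I : finType) (X : I -> T -> R) : Prop :=
  (forall i, measurable_fun [set: T] (X i)) /\
  forall B : I -> set R, (forall i, measurable (B i)) ->
    P [set w | forall i, B i (X i w)] = (\prod_i fine (gauss (B i)))%:E.

Lemma measurable_forall_preimage (I : finType) (X : I -> T -> R)
    (B : I -> set R) : (forall i, measurable_fun [set: T] (X i)) ->
  (forall i, measurable (B i)) -> measurable [set w | forall i, B i (X i w)].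
Proof.
move=> mX mB.
rewrite (_ : [set w | _] = \bigcap_(i in [set: I]) (X i @^-1` B i)).
  apply: fin_bigcap_measurable => // i _.
  by rewrite -[X in measurable X]setTI; exact: mX.
by apply/seteqP; split => w /= H i => [_|]; exact: H.
Qed.

Lemma standard_gaussian_iid_normal (n k : nat)
    (X : 'I_n -> 'I_k -> {RV P >-> R}) : standard_gaussian X ->
  iid_normal (fun ij => X ij.1 ij.2).
Proof.
case=> indX lawX; split=> [ij|B mB]; first exact: measurable_funP.
have := indX (finset.setTfor _) B mB.
rewrite (_ : \bigcap_(i in _) _ = [set w | forall i, B i (X i.1 i.2 w)]).
  move=> ->; rewrite -prodEFin; apply: eq_big => [i|i _]; first by rewrite inE.
  by rewrite fineK ?normal_prob_fin_num//; exact: (lawX _ _ _ (mB i)).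
apply/seteqP; split => w /= H i => [|_]; last exact: H.
by apply: H; rewrite /= inE.
Qed.

Lemma iid_normal_sign (I : finType) (X : I -> T -> R) (c : I -> R) :
  (forall i, c i ^+ 2 = 1) -> iid_normal X ->
  iid_normal (fun i w => c i * X i w).
Proof.
move=> c1 [mX lawX].
split=> [i|B mB]; first exact: measurable_funM.
have mcB i : measurable (( *%R (c i)) @^-1` B i).
  have mc : measurable_fun [set: R] ( *%R (c i)) by exact: measurable_funM.
  by rewrite -[X in measurable X]setTI; exact: mc.
rewrite [LHS](lawX (fun i => ( *%R (c i)) @^-1` B i))//; congr EFin.
apply: eq_bigr => i _; congr fine.
have /eqP := c1 i; rewrite sqrf_eq1 => /orP[]/eqP ->.
  by congr normal_prob; apply/seteqP; split => x /=; rewrite mul1r.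
rewrite -(normal_probN (mB i)); congr normal_prob.
by apply/seteqP; split => x /=; rewrite mulN1r.
Qed.

Lemma iid_normal_comp_inj (I J : finType) (X : I -> T -> R) (g : J -> I) :
  injective g -> iid_normal X -> iid_normal (fun j => X (g j)).
Proof.
move=> ginj [mX lawX]; split=> [j|B mB]; first exact: mX.
pose B' i := if [pick j | g j == i] is Some j then B j else setT.
have B'g j : B' (g j) = B j.
  rewrite /B'; case: pickP => [j' /eqP/ginj -> //|/(_ j)]; by rewrite eqxx.
have mB' i : measurable (B' i).
  by rewrite /B'; case: pickP => // *; exact: mB.
rewrite (_ : [set w | _] = [set w | forall i, B' i (X i w)]); last first.
  apply/seteqP; split => w /= H.
    by move=> i; rewrite /B'; case: pickP => // j /eqP <-; exact: H.
  by move=> j; rewrite -B'g; exact: H.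
rewrite lawX//; congr EFin.
rewrite (bigID (mem (codom g)))/= [X in _ * X]big1 ?mulr1.
  have pickg j : [pick j' | g j' == g j] = Some j.
    by case: pickP => [j' /eqP/ginj -> //|/(_ j)]; rewrite eqxx.
  rewrite (reindex_omap g (fun i => [pick j | g j == i])) => [|i /codomP[j ->]].
    by apply: eq_big => [j|j _]; rewrite ?B'g// pickg codom_f eqxx.
  by rewrite pickg.
move=> i ig; rewrite /B'; case: pickP => [j /eqP gj|_].
  by move: ig; rewrite -gj codom_f.
by rewrite probability_setT.
Qed.

(** Fix the sets B i for i <> p, q.  As a function of the set of values allowed
    for (X p, X q), the probability of the box is a measure on the plane which
    agrees on rectangles, hence everywhere, with K times the product of two
    normal laws, K being the contribution of the other variables.  That product
    is invariant under the reflection. *)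
Lemma iid_normal_reflection (I : finType) (X : I -> T -> R) (p q : I) (c s : R) :
  p != q -> 0 < s -> c ^+ 2 + s ^+ 2 = 1 -> iid_normal X ->
  iid_normal (fun i w => if i == p then c * X p w + s * X q w
                         else if i == q then s * X p w - c * X q w else X i w).
Proof.
move=> pq s0 cs [mX lawX].
set Y := fun i : I => _.
have mY i : measurable_fun [set: T] (Y i).
  rewrite /Y; case: eqP => _.
    by apply: measurable_funD; exact: measurable_funM.
  case: eqP => _ //.
  by apply: measurable_funB; exact: measurable_funM.
split => // B mB.
(* The box with sides D at p, E at q, and B elsewhere. *)
pose BC (D E : set R) i := if i == p then D else if i == q then E else B i.
have mBC D E i : measurable D -> measurable E -> measurable (BC D E i).
  by move=> mD mE; rewrite /BC; case: ifP => // _; case: ifP.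
pose C := [set w | forall i, BC setT setT i (X i w)].
have mC : measurable C by apply: measurable_forall_preimage => // i; exact: mBC.
pose XX : T -> measurableTypeR R * measurableTypeR R :=
  fun w => (X p w, X q w).
have mXX : measurable_fun [set: T] XX.
  by apply: measurable_fun_pair; exact: mX.
pose K := \prod_(i | (i != p) && (i != q)) fine (gauss (B i)).
have K0 : 0 <= K by apply: prodr_ge0 => i _; rewrite fine_ge0.
have splitK (F : I -> R) : \prod_i F i =
    F p * F q * \prod_(i | (i != p) && (i != q)) F i.
  rewrite (bigD1 p)//= (bigD1 q)/=; last by rewrite eq_sym.
  by rewrite mulrA.
have BCp D E : BC D E p = D by rewrite /BC eqxx.
have BCq D E : BC D E q = E by rewrite /BC eqxx eq_sym (negbTE pq).
have BCK D E : \prod_i fine (gauss (BC D E i)) =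
    fine (gauss D) * fine (gauss E) * K.
  rewrite splitK BCp BCq; congr (_ * _); apply: eq_bigr => i /andP[ip iq].
  by rewrite /BC (negbTE ip) (negbTE iq).
pose nu : {measure set (measurableTypeR R * measurableTypeR R) -> \bar R} :=
  pushforward (mrestr P mC) XX.
have nuE D E : measurable D -> measurable E ->
    nu mXX (D `*` E) = (mscale (NngNum K0) gauss D * gauss E)%E.
  move=> mD mE.
  have -> : nu mXX (D `*` E) = P [set w | forall i, BC D E i (X i w)].
    congr (P _); apply/seteqP; split => w /=.
      move=> [[Dw Ew] Cw] i; rewrite /BC; have := Cw i; rewrite /BC.
      by case: eqP => [-> //|_]; case: eqP => [-> //|].
    move=> H; split; first by have := H p; have := H q; rewrite BCp BCq.
    move=> i; have := H i; rewrite /BC.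
    by case: eqP => // _; case: eqP.
  rewrite lawX; last by move=> i; exact: mBC.
  rewrite BCK /mscale/= mulrC mulrA !EFinM.
  by rewrite !fineK ?normal_prob_fin_num.
have nuU S : measurable S -> (mscale (NngNum K0) gauss \x gauss)%E S = nu mXX S.
  move=> mS; apply: (@product_measure_unique _ _ (measurableTypeR R) (measurableTypeR R) R
    (mscale (NngNum K0) gauss) gauss (nu mXX)) => //.
pose refl (x : R * R) := (c * x.1 + s * x.2, s * x.1 - c * x.2).
have -> : P [set w | forall i, B i (Y i w)] =
    nu mXX (refl @^-1` (B p `*` B q)).
  congr (P _); apply/seteqP; split => w /=.
    move=> H; split.
      have := H p; have := H q; rewrite /Y eqxx eq_sym (negbTE pq) eqxx; by [].
    move=> i; have := H i; rewrite /BC /Y.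
    by case: eqP => // _; case: eqP.
  move=> [[/= Hp Hq] Cw] i; rewrite /Y; have := Cw i; rewrite /BC.
  by case: eqP => [-> //|_]; case: eqP => [-> //|].
have m1 : measurable_fun setT (fst : R * R -> R) by exact: measurable_fst.
have m2 : measurable_fun setT (snd : R * R -> R) by exact: measurable_snd.
have mrefl : measurable_fun setT refl.
  apply: measurable_fun_pair.
    by apply: measurable_funD; exact: measurable_funM.
  by apply: measurable_funB; exact: measurable_funM.
have mS : measurable (refl @^-1` (B p `*` B q)).
  by rewrite -[X in measurable X]setTI; apply: mrefl => //; exact: measurableX.
have mscaleE : (mscale (NngNum K0) gauss \x gauss)%E (refl @^-1` (B p `*` B q)) =
    mscale (NngNum K0) (gauss \x gauss)%E (refl @^-1` (B p `*` B q)).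
  apply: (@product_measure_unique _ _ (measurableTypeR R) (measurableTypeR R) R
    (mscale (NngNum K0) gauss) gauss
    (mscale (NngNum K0) (gauss \x gauss)%E)) => // D E mD mE.
  by rewrite /= /mscale/= product_measure1E// muleA.
rewrite -nuU// mscaleE /mscale/= normal_prod_reflection// splitK mulrC !EFinM.
by rewrite !fineK ?normal_prob_fin_num.
Qed.

End family.

(** * Isometries of row vectors that preserve Gaussian matrices *)

Section rows.
Context {R : realType} {d : measure_display} {T : measurableType d}.
Variable P : probability T R.
Variables n k : nat.
Implicit Types (f g e : 'I_k -> R) (Y : T -> 'I_n -> 'I_k -> R).

Definition row_dot f g : R := \sum_j f j * g j.

Definition gaussian_rows Y : Prop :=
  iid_normal P (fun (ij : 'I_n * 'I_k) w => Y w ij.1 ij.2).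

(** Operations on row vectors that preserve inner products and, applied to all
    the rows of a Gaussian matrix, give a Gaussian matrix.  They stand for right
    multiplication by an orthogonal matrix: applying one to the rows of X and to
    u at once leaves X u unchanged. *)
Definition gaussian_isometry (rho : ('I_k -> R) -> 'I_k -> R) : Prop :=
  (forall f g, row_dot (rho f) (rho g) = row_dot f g) /\
  (forall Y, gaussian_rows Y -> gaussian_rows (fun w i => rho (Y w i))).

Definition reflect_coords (a b : 'I_k) (c s : R) f (j : 'I_k) : R :=
  if j == a then c * f a + s * f b
  else if j == b then s * f a - c * f b else f j.

Lemma gaussian_isometry_comp rho1 rho2 : gaussian_isometry rho1 ->
  gaussian_isometry rho2 -> gaussian_isometry (rho2 \o rho1).
Proof.
move=> [dot1 rows1] [dot2 rows2]; split=> [f g|Y rY] /=; first by rewrite dot2.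
exact/rows2/rows1.
Qed.

Lemma gaussian_isometry_sign (c : 'I_k -> R) : (forall j, c j ^+ 2 = 1) ->
  gaussian_isometry (fun f j => c j * f j).
Proof.
move=> c1; split=> [f g|Y rY].
  by apply: eq_bigr => j _; rewrite mulrACA -expr2 c1 mul1r.
exact: (@iid_normal_sign _ _ _ _ _ _ (fun ij => c ij.2) (fun ij => c1 ij.2) rY).
Qed.

Lemma gaussian_isometry_reflection (a b : 'I_k) (c s : R) :
  a != b -> 0 < s -> c ^+ 2 + s ^+ 2 = 1 ->
  gaussian_isometry (reflect_coords a b c s).
Proof.
move=> ab s0 cs; have ba : (b == a) = false by rewrite eq_sym (negbTE ab).
split=> [f g|Y rY].
  have split2 (F : 'I_k -> R) :
      \sum_j F j = F a + F b + \sum_(j | (j != a) && (j != b)) F j.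
    by rewrite (bigD1 a)//= (bigD1 b) ?ba//= addrA.
  rewrite /row_dot !split2 /reflect_coords !eqxx ba; congr (_ + _).
    transitivity ((c ^+ 2 + s ^+ 2) * (f a * g a + f b * g b)); first by ring.
    by rewrite cs mul1r.
  by apply: eq_bigr => j /andP[ja jb]; rewrite (negbTE ja) (negbTE jb).
(* Independence is kept by reflecting one row at a time. *)
pose Z (r : seq 'I_n) (ij : 'I_n * 'I_k) w :=
  if ij.1 \in r then reflect_coords a b c s (Y w ij.1) ij.2 else Y w ij.1 ij.2.
have rZ (r : seq 'I_n) : uniq r -> iid_normal P (Z r).
  elim: r => [_|i0 r IH /= /andP[i0r /IH rZ]]; first exact: rY.
  have pq : (i0, a) != (i0, b) by rewrite xpair_eqE eqxx.
  have := iid_normal_reflection pq s0 cs rZ; congr iid_normal.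
  apply/funext => -[i j]; apply/funext => w.
  rewrite /Z/= !xpair_eqE in_cons (negbTE i0r).
  have [->/=|_//] := eqVneq i i0.
  by rewrite (negbTE i0r) /reflect_coords; case: (j == a) => //; case: (j == b).
have := rZ (enum 'I_n) (enum_uniq _); congr iid_normal.
by apply/funext => ij; apply/funext => w; rewrite /Z mem_enum.
Qed.

(** One reflection of the coordinates a and b clears the coordinate b of a
    vector; doing so for each b in r collects the length at a, and a sign change
    makes it nonnegative. *)
Lemma gaussian_isometry_eliminate (a : 'I_k) (r : seq 'I_k) e : a \notin r ->
  exists rho, [/\ gaussian_isometry rho,
    forall j, j \in r -> rho e j = 0,
    0 <= rho e a &
    forall f j, j != a -> j \notin r -> rho f j = f j].
Proof.
move=> ar.
suff [rho [irho rho0 rhof]] : exists rho, [/\ gaussian_isometry rho,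
    forall j, j \in r -> rho e j = 0 &
    forall f j, j != a -> j \notin r -> rho f j = f j].
  pose c (j : 'I_k) : R := if (j == a) && (rho e a < 0) then -1 else 1.
  have c1 j : c j ^+ 2 = 1 by rewrite /c; case: ifP; rewrite ?sqrrN expr1n.
  exists ((fun f j => c j * f j) \o rho); split => /=.
  - by apply: gaussian_isometry_comp => //; exact: gaussian_isometry_sign.
  - by move=> j jr; rewrite rho0// mulr0.
  - rewrite /c eqxx/=; case: ltP => e0; last by rewrite mul1r.
    by rewrite mulN1r oppr_ge0 ltW.
  - by move=> f j ja jr; rewrite /c (negbTE ja) mul1r rhof.
elim: r ar => [_|b r IH ar]; first by exists id.
have := ar; rewrite in_cons negb_or => /andP[ab /IH[rho [irho rho0 rhof]]].
have [eb0|eb0] := eqVneq (rho e b) 0.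
  exists rho; split => // [j|f j ja]; rewrite in_cons.
    by case: eqVneq => [->|_] //= jr; exact: rho0.
  by rewrite negb_or => /andP[_ jr]; exact: rhof.
set x := rho e a; set y := rho e b in eb0 *.
pose h := Num.sqrt (x ^+ 2 + y ^+ 2).
have hpos : 0 < x ^+ 2 + y ^+ 2.
  by rewrite ltr_wpDl ?sqr_ge0// exprn_even_gt0.
have h0 : 0 < h by rewrite sqrtr_gt0.
have h2 : h ^+ 2 = x ^+ 2 + y ^+ 2 by rewrite sqr_sqrtr// ltW.
(* The reflection sends (x, y) to (sg y * h, 0); the sign of y is put in c
   so that s is positive. *)
pose s := `|y| / h; pose c := Num.sg y * x / h.
have s0 : 0 < s by rewrite divr_gt0// normr_gt0.
have cs : c ^+ 2 + s ^+ 2 = 1.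
  rewrite /c /s !expr_div_n -mulrDl exprMn sqr_sg eb0 mul1r real_normK ?num_real//.
  by rewrite -h2 divff// expf_neq0// gt_eqF.
exists (reflect_coords a b c s \o rho); split => /=.
- apply: gaussian_isometry_comp => //; exact: gaussian_isometry_reflection.
- move=> j; rewrite in_cons /reflect_coords; case: eqVneq => [->|jb] /= jr.
    rewrite eq_sym (negbTE ab) -/x -/y /s /c normrEsg.
    by ring.
  have [ja|_] := eqVneq j a; last exact: rho0.
  by move: jr ar; rewrite ja in_cons => ->; rewrite orbT.
- move=> f j ja; rewrite in_cons negb_or => /andP[jb jr].
  by rewrite /reflect_coords (negbTE ja) (negbTE jb) rhof.
Qed.

Lemma gaussian_isometry_unit (a : 'I_k) e : row_dot e e = 1 ->
  exists2 rho, gaussian_isometry rho & rho e = fun j => (j == a)%:R.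
Proof.
move=> e1; pose r := [seq j <- enum 'I_k | j != a].
have rE j : (j \in r) = (j != a) by rewrite mem_filter mem_enum andbT.
have [|rho [irho rho0 rhoa _]] := @gaussian_isometry_eliminate a r e.
  by rewrite rE eqxx.
exists rho => //; apply/funext => j; have [->|ja] := eqVneq j a; last first.
  by rewrite rho0 ?rE.
have := irho.1 e e; rewrite e1 /row_dot (bigD1 a)//= big1 ?addr0; last first.
  by move=> i ia; rewrite rho0 ?rE// mul0r.
by move=> /eqP; rewrite -expr2 sqrf_eq1 => /orP[|] /eqP // rN; move: rhoa;
  rewrite rN ler0N1.
Qed.

(** First e is carried to the basis vector of a.  A second elimination, on the
    coordinates other than a, preserves the image of e and collects at b what
    remains of f; the coordinate of f at a is its inner product with e, and the
    one at b follows because f is a unit vector. *)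
Lemma gaussian_isometry_pair (a b : 'I_k) e f : a != b ->
  row_dot e e = 1 -> row_dot f f = 1 ->
  exists rho, [/\ gaussian_isometry rho, rho e = (fun j => (j == a)%:R) &
    rho f = fun j => if j == a then row_dot e f else
      if j == b then Num.sqrt (1 - row_dot e f ^+ 2) else 0].
Proof.
move=> ab e1 f1.
have [rho1 irho1 rho1e] := gaussian_isometry_unit a e1.
pose r := [seq j <- enum 'I_k | (j != a) && (j != b)].
have rE j : (j \in r) = (j != a) && (j != b) by rewrite mem_filter mem_enum andbT.
have [|rho2 [irho2 rho20 rho2b rho2a]] :=
  @gaussian_isometry_eliminate b r (rho1 f); first by rewrite rE eqxx andbF.
have irho := gaussian_isometry_comp irho1 irho2.
have fixa g : rho2 g a = g a by apply: rho2a; rewrite ?rE ?eqxx.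
exists (rho2 \o rho1); split => //.
  apply/funext => j /=; have [->|ja] := eqVneq j a.
    by rewrite fixa rho1e eqxx.
  have := irho.1 e e; rewrite e1 /row_dot (bigD1 a)//= fixa rho1e eqxx mulr1.
  move=> /eqP; rewrite -[X in _ == X]addr0 (inj_eq (addrI _)) psumr_eq0.
    move=> /allP/(_ j); rewrite mem_index_enum ja/= -expr2 sqrf_eq0.
    by move=> /(_ isT)/eqP.
  by move=> i _; rewrite -expr2 sqr_ge0.
have dotef : rho1 f a = row_dot e f.
  rewrite -(irho1.1 e f) rho1e /row_dot (bigD1 a)//= eqxx mul1r big1 ?addr0//.
  by move=> j /negbTE ->; rewrite mul0r.
apply/funext => j /=; have [->|ja] := eqVneq j a; first by rewrite fixa.
have [->|jb] := eqVneq j b; last by rewrite rho20 ?rE ?ja.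
have := irho.1 f f; rewrite f1 /row_dot (bigD1 a)//= fixa (bigD1 b)/=; last first.
  by rewrite eq_sym.
rewrite big1 ?addr0 => [|i /andP[ia ib]]; last by rewrite rho20 ?mul0r// rE ia.
rewrite -/(row_dot e f) dotef -!expr2 => <-.
by rewrite addrAC subrr add0r sqrtr_sqr ger0_norm.
Qed.

End rows.

(** * Normalised vectors, and integrals determined by the law *)

Section directions.
Context {R : realType} {n : nat}.
Implicit Types x y : 'cV[R]_n.

Definition direction x : 'cV[R]_n := (enorm x)^-1 *: x.

Lemma dotpZ a b x y : dotp (a *: x) (b *: y) = a * b * dotp x y.
Proof.
by rewrite /dotp mulr_sumr; apply: eq_bigr => i _; rewrite !mxE mulrACA.
Qed.

Lemma dotp_ge0 x : 0 <= dotp x x.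
Proof. by apply: sumr_ge0 => i _; rewrite -expr2 sqr_ge0. Qed.

Lemma dotp_eq0 x : dotp x x = 0 -> x = 0.
Proof.
move=> /eqP; rewrite psumr_eq0 => [/allP x0|i _]; last by rewrite -expr2 sqr_ge0.
apply/colP => i; rewrite !mxE.
by have := x0 i; rewrite mem_index_enum -expr2 sqrf_eq0 => /(_ isT)/eqP.
Qed.

(** The squared norms of x - y and x + y are nonnegative. *)
Lemma dotp_le x y : dotp x y <= (dotp x x + dotp y y) / 2 /\
  - ((dotp x x + dotp y y) / 2) <= dotp x y.
Proof.
rewrite /dotp -big_split/= mulr_suml -sumrN.
by split; apply: ler_sum => i _;
  have := sqr_ge0 (x i 0 - y i 0); have := sqr_ge0 (x i 0 + y i 0); nra.
Qed.

Lemma direction_usphere x : x != 0 -> usphere (direction x).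
Proof.
move=> x0; rewrite /usphere/= dotpZ -invfM -expr2 sqr_sqrtr ?dotp_ge0//.
by rewrite mulVf//; apply: contra_neq x0; exact: dotp_eq0.
Qed.

Lemma norm_dotp_direction x y : `|dotp (direction x) (direction y)| <= 1.
Proof.
have dir1 z : dotp (direction z) (direction z) <= 1.
  have [->|z0] := eqVneq z 0; last by rewrite (direction_usphere z0).
  by rewrite /direction scaler0 /dotp big1 ?ler01// => i _; rewrite mxE mul0r.
have [] := dotp_le (direction x) (direction y); have := dir1 x; have := dir1 y.
rewrite ler_norml; set a := dotp _ _; set b := dotp _ _; set c := dotp _ _.
by move=> *; apply/andP; split; lra.
Qed.

Lemma measurable_dotp {d} {T : measurableType d} (f g : T -> 'cV[R]_n) :
  (forall i, measurable_fun [set: T] (fun w => f w i 0)) ->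
  (forall i, measurable_fun [set: T] (fun w => g w i 0)) ->
  measurable_fun [set: T] (fun w => dotp (f w) (g w)).
Proof.
by move=> mf mg; apply: measurable_sum => i; exact: measurable_funM.
Qed.

Lemma measurable_dotp_direction {d} {T : measurableType d} (f g : T -> 'cV[R]_n) :
  (forall i, measurable_fun [set: T] (fun w => f w i 0)) ->
  (forall i, measurable_fun [set: T] (fun w => g w i 0)) ->
  measurable_fun [set: T] (fun w => dotp (direction (f w)) (direction (g w))).
Proof.
have mdir (h : T -> 'cV[R]_n) : (forall i, measurable_fun [set: T] (fun w => h w i 0)) ->
    forall i, measurable_fun [set: T] (fun w => direction (h w) i 0).
  move=> mh i.
  (* Inversion is measurable as a power function; at 0 both
     conventions give 0. *)
  under eq_fun do rewrite mxE /enorm -powR12_sqrt ?dotp_ge0// -powRN.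
  apply: measurable_funM => //.
  apply: (@measurableT_comp _ _ _ _ _ _ (@powR R ^~ (- 2^-1))).
    exact: measurable_powR.
  exact: measurable_dotp.
by move=> mf mg; apply: measurable_dotp => i; exact: mdir.
Qed.

End directions.

Lemma bounded_integrable {R : realType} {d} {T : measurableType d}
    (P : probability T R) (f : T -> R) (M : R) : measurable_fun [set: T] f ->
  (forall w, `|f w| <= M) -> P.-integrable [set: T] (EFin \o f).
Proof.
move=> mf fM; apply: measurable_bounded_integrable => //.
  by apply: (le_lt_trans (probability_le1 _ _)) => //; rewrite ltry.
by exists M; split; rewrite ?num_real// => x Mx w _ /=; rewrite (le_trans (fM w))// ltW.
Qed.

Section uniqueness_in_law.
Context {R : realType} {I : finType}.

(** A generator, closed under intersection, of the product sigma-algebra on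
    I -> R. *)
Definition boxes : set (set (I -> R)) :=
  [set [set x | forall i, B i (x i)] | B in [set B | forall i, measurable (B i)]].

Lemma measurable_coordinate i :
  measurable_fun setT (fun x : g_sigma_algebraType boxes => (x i : R)).
Proof.
move=> _ B mB; rewrite setTI; apply: sub_sigma_algebra.
exists (fun j => if j == i then B else setT) => [j /=|].
  by case: ifP.
apply/seteqP; split => x /=; first by move=> /(_ i); rewrite eqxx.
by move=> Bxi j; case: eqP => [->|].
Qed.

(** The laws of both families on I -> R agree on boxes, hence on the
    sigma-algebra which they generate. *)
Lemma iid_normal_integral_unique
    (d1 d2 : measure_display) (T1 : measurableType d1) (T2 : measurableType d2)
    (P1 : probability T1 R) (P2 : probability T2 R)
    (X1 : I -> T1 -> R) (X2 : I -> T2 -> R) (F : g_sigma_algebraType boxes -> R)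
    (M : R) :
  iid_normal P1 X1 -> iid_normal P2 X2 ->
  measurable_fun setT F -> (forall x, `|F x| <= M) ->
  (\int[P1]_w (F (X1^~ w))%:E = \int[P2]_w (F (X2^~ w))%:E)%E.
Proof.
move=> [mX1 law1] [mX2 law2] mF FM.
pose S := g_sigma_algebraType boxes.
have mX d (T : measurableType d) (X : I -> T -> R) :
    (forall i, measurable_fun setT (X i)) ->
    measurable_fun [set: T] (fun w => X^~ w : S).
  move=> mXi; apply: (@measurability _ _ T S setT (fun w => X^~ w : S) boxes) => //.
  by move=> _ [_ [B mB <-] <-]; rewrite setTI; exact: measurable_forall_preimage.
have push d (T : measurableType d) (P : probability T R) (X : I -> T -> R)
    (mXi : forall i, measurable_fun setT (X i)) :
    (\int[P]_w (F (X^~ w))%:E =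
     \int[pushforward P (fun w => X^~ w : S)]_x (F x)%:E)%E.
  rewrite integral_pushforward//; [exact: mX|exact/measurable_EFinP|].
  apply: (@bounded_integrable _ _ _ P (F \o (fun w => X^~ w)) M) => //.
    exact: (measurableT_comp mF (mX _ _ _ mXi)).
  by move=> w; exact: FM.
pose nu1 : {measure set S -> \bar R} := pushforward P1 (fun w => X1^~ w : S).
pose nu2 : {measure set S -> \bar R} := pushforward P2 (fun w => X2^~ w : S).
have nuE A : measurable A ->
    nu1 (mX _ _ _ mX1) A = nu2 (mX _ _ _ mX2) A.
  apply: (@measure_unique _ R S boxes (fun=> setT)) => //.
  - move=> _ _ [B mB <-] [C mC <-]; exists (fun i => B i `&` C i).
      by move=> i; exact: measurableI.
    apply/seteqP; split => x /=; first by move=> BC; split=> i; have [] := BC i.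
    by move=> [Bx Cx] i; split.
  - by move=> _; exists (fun=> setT) => //; apply/seteqP; split.
  - by apply/seteqP; split => // x _; exists 0%N.
  - by move=> _ [B mB <-]; rewrite [LHS]law1//; apply/esym/law2.
  - by move=> _; rewrite (_ : nu1 _ _ = 1%E) ?ltry//; exact: probability_setT P1.
rewrite !push//; apply: (@eq_measure_integral _ S R setT (nu2 (mX _ _ _ mX2))
  (nu1 (mX _ _ _ mX1))) => A mA _.
exact: (nuE A mA).
Qed.

End uniqueness_in_law.

(** * Rounded vectors and the function E_n *)

Section rounded_vectors.
Context {R : realType} {d : measure_display} {T : measurableType d}.
Variables (P : probability T R) (n k : nat) (X : 'I_n -> 'I_k -> {RV P >-> R}).

Lemma measurable_image_coordinate (u : 'cV[R]_k) i :
  measurable_fun [set: T] (fun w => (matrix_at X w *m u) i 0).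
Proof.
under eq_fun do (rewrite mxE; under eq_bigr do rewrite mxE).
by apply: measurable_sum => j; exact: measurable_funM.
Qed.

Lemma measurable_dotp_rounding (u v : 'cV[R]_k) :
  measurable_fun [set: T] (fun w => dotp (rounding (matrix_at X w) u)
                                         (rounding (matrix_at X w) v)).
Proof.
apply: (@measurable_dotp_direction R n _ _ (fun w => matrix_at X w *m u)
  (fun w => matrix_at X w *m v)) => i; exact: measurable_image_coordinate.
Qed.

Lemma integrable_dotp_rounding (u v : 'cV[R]_k) :
  P.-integrable [set: T] (fun w => (dotp (rounding (matrix_at X w) u)
                                        (rounding (matrix_at X w) v))%:E).
Proof.
apply: (@bounded_integrable _ _ _ P (fun w => dotp (rounding (matrix_at X w) u)
  (rounding (matrix_at X w) v)) 1); first exact: measurable_dotp_rounding.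
by move=> w; exact: norm_dotp_direction.
Qed.

Context (X_gauss : standard_gaussian X).

Let rows_gauss : gaussian_rows P (fun w i j => X i j w).
Proof. exact: standard_gaussian_iid_normal X_gauss. Qed.

Lemma mulmx_row_dot w (u : 'cV[R]_k) i :
  (matrix_at X w *m u) i 0 = row_dot (fun j => X i j w) (fun j => u j 0).
Proof. by rewrite mxE; apply: eq_bigr => j _; rewrite mxE. Qed.

(** An isometry that carries u to the basis vector of a and v into the span of
    those of a and b turns X into a Gaussian matrix whose columns a and b are the
    required Z. *)
Lemma gaussian_image_pair (a b : 'I_k) (u v : 'cV[R]_k) :
    a != b -> usphere u -> usphere v ->
  exists2 Z : 'I_n * bool -> T -> R, iid_normal P Z & forall w,
    matrix_at X w *m u = \col_i Z (i, true) w /\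
    matrix_at X w *m v = \col_i (dotp u v * Z (i, true) w +
      Num.sqrt (1 - dotp u v ^+ 2) * Z (i, false) w).
Proof.
move=> ab u1 v1.
have [rho [[rho_dot rho_rows] rhou rhov]] :=
  @gaussian_isometry_pair R d T P n k a b (fun j => u j 0) (fun j => v j 0) ab u1 v1.
pose Z (ic : 'I_n * bool) w :=
  rho (fun j => X ic.1 j w) (if ic.2 then a else b).
exists Z => [|w].
  pose g (ic : 'I_n * bool) := (ic.1, if ic.2 then a else b).
  have ginj : injective g.
    move=> [i c] [i' c'] [-> ]; case: c; case: c' => // /eqP.
      by rewrite (negbTE ab).
    by rewrite eq_sym (negbTE ab).
  exact: (iid_normal_comp_inj ginj (rho_rows _ rows_gauss)).
split; apply/colP => i; rewrite mulmx_row_dot -rho_dot mxE.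
  rewrite rhou /row_dot (bigD1 a)//= eqxx mulr1 big1 ?addr0// => j /negbTE ->.
  by rewrite mulr0.
rewrite rhov -[row_dot (fun j => u j 0) _]/(dotp u v) /row_dot.
rewrite (bigD1 a)//= eqxx (bigD1 b)/=; last by rewrite eq_sym.
rewrite eqxx eq_sym (negbTE ab) big1 ?addr0; last first.
  by move=> j /andP[/negbTE -> /negbTE ->]; rewrite mulr0.
by rewrite mulrC [X in _ + X]mulrC.
Qed.

(** Carrying u to a basis vector exhibits a coordinate of X u as a standard
    normal variable, which vanishes with probability 0. *)
Lemma ae_usphere_rounding (a : 'I_k) (u : 'cV[R]_k) : (0 < n)%N -> usphere u ->
  {ae P, forall w, usphere (rounding (matrix_at X w) u)}.
Proof.
move=> n0 u1.
have [rho [rho_dot rho_rows] rhou] := @gaussian_isometry_unit R d T P n k a _ u1.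
have [mY lawY] := rho_rows _ rows_gauss.
pose i0 := Ordinal n0.
pose Z w := rho (fun j => X i0 j w) a.
have mZ : measurable (Z @^-1` [set 0]).
  by rewrite -[X in measurable X]setTI; apply: (mY (i0, a)).
exists (Z @^-1` [set 0]); split => //.
  rewrite (_ : _ @^-1` _ = [set w | forall ij : 'I_n * 'I_k,
      (if ij == (i0, a) then [set 0] else setT)
        (rho (fun j => X ij.1 j w) ij.2)]); last first.
    apply/seteqP; split => w /=.
      by move=> Zw ij; case: eqP => [->|].
    by move=> /(_ (i0, a)); rewrite eqxx.
  rewrite (lawY (fun ij => if ij == (i0, a) then [set 0] else setT)); last first.
    by move=> ij; case: ifP.
  rewrite (bigD1 (i0, a))//= eqxx.
  have /null_content_dominatesP := normal_prob_dominates (0 : R) 1.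
  move=> ->//; first by rewrite mul0r.
  exact: lebesgue_measure_set1.
move=> w /= w_notin; apply: contra_notP w_notin => Zw; apply: direction_usphere.
apply: contra_not_neq Zw => /colP/(_ i0).
rewrite mulmx_row_dot -rho_dot rhou /row_dot (bigD1 a)//= eqxx mulr1 mxE.
by rewrite big1 ?addr0// => j /negbTE ->; rewrite mulr0.
Qed.

End rounded_vectors.

Section En_well_defined.
Context {R : realType}.

(** The integrand of E_n(t) in normal form. *)
Definition rounded_correlation (n : nat) (t : R) (z : 'I_n * bool -> R) : R :=
  dotp (direction (\col_i z (i, true)))
       (direction (\col_i (t * z (i, true) + Num.sqrt (1 - t ^+ 2) * z (i, false)))).

Lemma En_value_unique (n : nat) (t e1 e2 : R) :
  En_value n t e1 -> En_value n t e2 -> e1 = e2.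
Proof.
have nf (e : R) : En_value n t e -> exists (d : measure_display)
    (T : measurableType d) (P : probability T R) (Z : 'I_n * bool -> T -> R),
    iid_normal P Z /\
    (\int[P]_w (rounded_correlation t (Z^~ w))%:E)%E = e%:E.
  move=> [k [u [v [d [T [P [X [k2 [u1 v1] uvt Xg]]]]]]]]; rewrite unlock => <-.
  have k0 : (0 < k)%N by exact: ltn_trans k2.
  have ab : Ordinal k0 != Ordinal k2 by [].
  have [Z Zg XZ] := gaussian_image_pair Xg ab u1 v1.
  exists d, T, P, Z; split => //; apply: eq_integral => w _; congr EFin.
  rewrite /rounding; have [-> ->] := XZ w.
  by rewrite uvt.
move=> /nf[d1 [T1 [P1 [Z1 [Z1g E1]]]]] /nf[d2 [T2 [P2 [Z2 [Z2g E2]]]]].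
apply: EFin_inj; rewrite -E1 -E2.
apply: (@iid_normal_integral_unique R _ _ _ _ _ _ _ _ _
  (@rounded_correlation n t) 1) => //; last first.
  by move=> x; exact: norm_dotp_direction.
pose S := g_sigma_algebraType (@boxes R ('I_n * bool)%type).
apply: measurable_dotp_direction => i.
  apply: (eq_measurable_fun (fun z : S => z (i, true))) => [z _|].
    by rewrite mxE.
  exact: measurable_coordinate.
apply: (eq_measurable_fun (fun z : S =>
  t * z (i, true) + Num.sqrt (1 - t ^+ 2) * z (i, false))) => [z _|].
  by rewrite mxE.
by apply: measurable_funD; apply: measurable_funM => //;
  exact: measurable_coordinate.
Qed.

Lemma En_valueE (n : nat) (t e : R) : En_value n t e -> En n t = e.
Proof. by move=> te; apply: xget_unique => // e' /En_value_unique; exact. Qed.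

(** If E_n(t) had no candidate value, it would be the default value 0. *)
Lemma En_le1 (n : nat) (t : R) : En n t <= 1.
Proof.
rewrite /En; case: xgetP => [e _|_]; last exact: ler01.
move=> [k [u [v [d [T [P [X [_ _ _ _]]]]]]]].
rewrite unlock -lee_fin => <-.
rewrite [leRHS](_ : _ = \int[P]_w (1 : R)%:E)%E; last first.
  by rewrite integral_cst// mul1e; apply/esym/(probability_setT P).
apply: le_integral => //; first exact: integrable_dotp_rounding.
  by apply: (@bounded_integrable _ _ _ P (cst 1) 1) => // w; rewrite normr1.
by move=> w _; rewrite lee_fin (le_trans (ler_norm _))// norm_dotp_direction.
Qed.

Lemma vn_le (n : nat) (t : R) : -1 <= t < 1 -> vn n <= (1 - En n t) / (1 - t).
Proof.
move=> t1; apply: ge_inf; last by exists t.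
exists 0 => _ [s /= /andP[_ s1] <-].
by rewrite divr_ge0 ?subr_ge0 ?En_le1// ltW.
Qed.

End En_well_defined.

(** * The approximation ratio *)

Unset Implicit Arguments.

Theorem mainTheorem4 (R : realType) (n m : nat) (n_gt0 : (0 < n)%N)
    (m_gt0 : (0 < m)%N) (A : 'M[R]_m) (A_psd : psd A)
    (A_offdiag : forall i j : 'I_m, i != j -> A i j <= 0)
    (A_colsum : forall j : 'I_m, \sum_(i < m) A i j = 0)
    (u : 'I_m -> 'cV[R]_m) (u_opt : SDPoo_optimal A u)
    (d : measure_display) (T : measurableType d) (P : probability T R)
    (X : 'I_n -> 'I_m -> {RV P >-> R}) (X_gauss : standard_gaussian X) :
  let x (i : 'I_m) (w : T) : 'cV[R]_n := rounding (matrix_at X w) (u i) in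
  {ae P, forall w, forall i, usphere (x i w)} /\
  ((vn n * SDPoo A)%:E <=
     'E_P[fun w => (\sum_(i < m) \sum_(j < m) A i j * dotp (x i w) (x j w))%R])%E.
Proof.
move=> x; have [u1 SDPE] := u_opt.
pose j0 := Ordinal m_gt0.
have ae_x i : {ae P, forall w, usphere (x i w)}.
  exact: (ae_usphere_rounding X_gauss j0 n_gt0 (u1 i)).
split.
  have /ae_foralln : forall k : nat,
      \forall w \ae P, forall i : 'I_m, i = k :> nat -> usphere (x i w).
    move=> k; have [km|mk] := ltnP k m.
      have := ae_x (Ordinal km); apply: filterS => w xw i ik.
      by rewrite (_ : i = Ordinal km)//; exact/val_inj.
    by apply: nearW => w i ik; have := ltn_ord i; rewrite ik ltnNge mk.
  by apply: filterS => w xw i; exact: (xw i).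
pose E i j := (\int[P]_w (dotp (x i w) (x j w))%:E)%E.
have intE i j : P.-integrable [set: T] (fun w => (dotp (x i w) (x j w))%:E).
  exact: integrable_dotp_rounding.
pose e i j := fine (E i j).
have eE i j : E i j = (e i j)%:E by rewrite fineK// integrable_fin_num.
have eii i : e i i = 1.
  apply: EFin_inj; rewrite -eE /E (@ae_eq_integral _ _ _ P setT (cst 1%E))//.
  - by rewrite integral_cst// mul1e; exact: (probability_setT P).
  - exact: (measurable_int P (intE i i)).
  - by have := ae_x i; apply: filterS => w xw _ /=; rewrite xw.
have eij i j : i != j -> En n (dotp (u i) (u j)) = e i j.
  move=> ij; apply: En_valueE; exists m, (u i), (u j), d, T, P, X; split => //.
  - rewrite ltnNge; apply: contraNN ij => m1; apply/eqP/val_inj.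
    have := leq_trans (ltn_ord i) m1; have := leq_trans (ltn_ord j) m1.
    by rewrite !ltnS !leqn0 => /eqP j_0 /eqP i_0; rewrite /= i_0 j_0.
  - by rewrite unlock; exact: eE.
have lin : 'E_P[fun w => (\sum_(i < m) \sum_(j < m) A i j * dotp (x i w) (x j w))%R]%E
    = (\sum_i \sum_j A i j * e i j)%:E.
  rewrite unlock; transitivity (\int[P]_w (\sum_i \sum_j
      (A i j)%:E * (dotp (x i w) (x j w))%:E))%E.
    apply: eq_integral => w _; rewrite -sumEFin; apply: eq_bigr => i _.
    by rewrite -sumEFin; apply: eq_bigr => j _; rewrite EFinM.
  rewrite integral_sum// => [|i]; last first.
    by apply: integrable_sum => // j _; exact: integrableZl.
  rewrite -sumEFin; apply: eq_bigr => i _.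
  rewrite integral_sum// => [|j]; last exact: integrableZl.
  rewrite -sumEFin; apply: eq_bigr => j _.
  by rewrite integralZl// EFinM -eE.
have rowsum i : \sum_j A i j = 0.
  rewrite -[RHS](A_colsum i); apply: eq_bigr => j _.
  by rewrite -[in LHS](A_psd.1) mxE.
have shift (f : 'I_m -> 'I_m -> R) :
    \sum_i \sum_j A i j * f i j = \sum_i \sum_j - A i j * (1 - f i j).
  apply: eq_bigr => i _; rewrite -[LHS]subr0 -[X in _ - X](rowsum i) -sumrB.
  by apply: eq_bigr => j _; ring.
rewrite lin lee_fin -SDPE !shift mulr_sumr; apply: ler_sum => i _.
rewrite mulr_sumr; apply: ler_sum => j _.
have [<-|ij] := eqVneq i j.
  by rewrite eii u1 subrr !mulr0.
have [t1 tN1] := dotp_le (u i) (u j).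
move: t1 tN1; rewrite (u1 i) (u1 j) => t1 tN1.
rewrite mulrCA ler_wpM2l ?oppr_ge0 ?A_offdiag// -eij//.
set t := dotp _ _ in t1 tN1 *.
(* At t = 1 there is no quotient to compare with; 1 - E_n(1) >= 0 suffices. *)
have [->|tn1] := eqVneq t 1; first by rewrite subrr mulr0 subr_ge0 En_le1.
have tlt1 : t < 1 by rewrite lt_neqAle tn1/=; lra.
rewrite -ler_pdivlMr ?subr_gt0// vn_le// tlt1 andbT; lra.
Qed.
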